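(* Let $\mathfrak{H}$ be a $p$-Schunck class which contains all atoms. Let $(L,[p])\in\mathfrak{H}$ and let $[p]'$ be another $p$-operation on the Lie algebra $L$. Then $(L,[p]')\in\mathfrak{H}$.
   Context: All Lie algebras are finite-dimensional over a fixed field $F$ of characteristic $p\neq 0$. A restricted Lie algebra $(L,[p])$ is a Lie algebra $L$ with a $p$-operation $x\mapsto x^{[p]}$ in the usual sense; it is soluble if the Lie algebra $L$ is. A $[p]$-subalgebra is a subalgebra $U$ with $U^{[p]}\subseteq U$; a $[p]$-ideal is an ideal which is a $[p]$-subalgebra. For a $[p]$-ideal $K$, $L/K$ carries the induced $p$-operation. A minimal $[p]$-ideal is one minimal among the nonzero $[p]$-ideals. A class of soluble restricted Lie algebras is a collection of such algebras closed under isomorphism (of restricted Lie algebras). A soluble restricted Lie algebra $(L,[p])$ is primitive if it has a minimal $[p]$-ideal $A$ whose centraliser $\mathcal{C}_L(A)$ equals $A$. A $p$-Schunck class is a non-empty class $\mathfrak{X}$ which is equal to the class of all soluble restricted Lie algebras $(L,[p])$ such that every primitive quotient $(L/K,[p])$ ($K$ a $[p]$-ideal) is in $\mathfrak{X}$. An atom is a nonzero soluble restricted Lie algebra (necessarily abelian) whose only $[p]$-subalgebras are $0$ and itself. *)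

(* Defs.v *)
From HB Require Import structures.
From mathcomp Require Import all_boot all_order all_algebra.

Set Implicit Arguments.
Unset Strict Implicit.
Unset Printing Implicit Defensive.

Import GRing.Theory.
Import Quotient.
Local Open Scope ring_scope.
Local Open Scope quotient_scope.

Reserved Notation "\[ x , y ]" (at level 0, x, y at level 200,
  format "\[ x ,  y ]").

HB.mixin Record isLieAlgebra (F : fieldType) L of Vector F L := {
  lieb : L -> L -> L;
  liebl_linear : forall y, linear (lieb^~ y);
  liebr_linear : forall x, linear (lieb x);
  liebxx : forall x, lieb x x = 0;
  lieb_jacobi : forall x y z,
    lieb x (lieb y z) + lieb y (lieb z x) + lieb z (lieb x y) = 0
}.

#[short(type="lieAlgType")]
HB.structure Definition LieAlgebra (F : fieldType) :=
  { L of isLieAlgebra F L & Vector F L }.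

Notation "\[ x , y ]" := (lieb x y) : ring_scope.

Section Bracket.
Variables (F : fieldType) (L : lieAlgType F).
Implicit Types (x y z : L) (U V W : {vspace L}).

HB.instance Definition _ x :=
  GRing.isLinear.Build F L L *:%R (@lieb F L x) (@liebr_linear F L x).

Lemma liebDl x y z : \[x + y, z] = \[x, z] + \[y, z].
Proof. by have := liebl_linear z 1 x y; rewrite !scale1r. Qed.

Lemma lieb0l z : \[0, z] = 0 :> L.
Proof. by apply: (@addrI _ \[0, z]); rewrite -liebDl !addr0. Qed.

Lemma liebZl a x z : \[a *: x, z] = a *: \[x, z].
Proof. by have := liebl_linear z a x 0; rewrite lieb0l !addr0. Qed.

Lemma liebDr x y z : \[x, y + z] = \[x, y] + \[x, z].
Proof. exact: raddfD. Qed.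

Lemma liebZr a x z : \[x, a *: z] = a *: \[x, z].
Proof. exact: linearZ. Qed.

Lemma liebNl x y : \[- x, y] = - \[x, y].
Proof. by rewrite -scaleN1r liebZl scaleN1r. Qed.

Lemma liebNr x y : \[x, - y] = - \[x, y].
Proof. exact: raddfN. Qed.

Lemma lieb0r x : \[x, 0] = 0.
Proof. exact: raddf0. Qed.

Lemma liebC x y : \[x, y] = - \[y, x].
Proof.
apply/eqP; rewrite -addr_eq0; apply/eqP.
by have := liebxx (x + y); rewrite liebDl !liebDr !liebxx addr0 add0r.
Qed.

Lemma lieb_suml I (r : seq I) (P : pred I) (f : I -> L) z :
  \[\sum_(i <- r | P i) f i, z] = \sum_(i <- r | P i) \[f i, z].
Proof.
exact: (big_morph (fun x => \[x, z]) (fun x y => liebDl x y z) (lieb0l z)).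
Qed.

Definition brv U V : {vspace L} :=
  <<[seq \[u, v] | u <- vbasis U, v <- vbasis V]>>%VS.

Lemma memv_brv U V u v : u \in U -> v \in V -> \[u, v] \in brv U V.
Proof.
move=> /coord_vbasis -> /coord_vbasis ->.
rewrite lieb_suml memv_suml // => i _; rewrite raddf_sum memv_suml // => j _.
rewrite /= liebZl liebZr !memvZ // memv_span //.
by apply/allpairsP; exists ((vbasis U)`_i, (vbasis V)`_j);
  rewrite !mem_nth ?size_tuple.
Qed.

Lemma brv_subP U V W :
  (forall u v, u \in U -> v \in V -> \[u, v] \in W) <-> (brv U V <= W)%VS.
Proof.
split=> [sW | /subvP sW u v uU vV]; last exact/sW/memv_brv.
apply/span_subvP => _ /allpairsP[[u v] /= [uU vV ->]].
by apply: sW; apply: vbasis_mem.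
Qed.

Definition derived_series (n : nat) : {vspace L} :=
  iter n (fun U => brv U U) fullv.

Definition soluble : Prop := exists n, derived_series n = 0%VS.

Definition subalgebra U : Prop :=
  forall x y, x \in U -> y \in U -> \[x, y] \in U.

Definition ideal U : Prop := forall x y, y \in U -> \[x, y] \in U.

Definition centv U : {vspace L} :=
  (\bigcap_(a <- vbasis U) lker (linfun (@lieb F L a)))%VS.

Lemma mem_bigcapv (I : eqType) (r : seq I) (f : I -> {vspace L}) x :
  reflect (forall i, i \in r -> x \in f i) (x \in (\bigcap_(i <- r) f i)%VS).
Proof.
elim: r => [|a r IH]; first by rewrite big_nil memvf; apply: ReflectT.
rewrite big_cons memv_cap; apply: (iffP andP) => [[xa /IH xr] i | xr].
  by rewrite inE => /predU1P[-> //|/xr].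
by split; [apply: xr; rewrite mem_head | apply/IH => i ir; apply: xr;
  rewrite inE ir orbT].
Qed.

Lemma centvP U x : (x \in centv U) <-> (forall a, a \in U -> \[x, a] = 0).
Proof.
split=> [/mem_bigcapv cx a /coord_vbasis -> | cx].
  rewrite raddf_sum big1 // => i _; rewrite /= liebZr liebC.
  have /cx : (vbasis U)`_i \in vbasis U by rewrite mem_nth ?size_tuple.
  by rewrite memv_ker lfunE => /eqP /= ->; rewrite oppr0 scaler0.
apply/mem_bigcapv => a /vbasis_mem /cx xa0.
by rewrite memv_ker lfunE /= liebC xa0 oppr0.
Qed.

(* An element of L[t] is encoded by its sequence of coefficients, and adpoly   *)
(* x y is ad (t x + y); thus i s_i(x, y) is the coefficient of t^(i-1) in      *)
(* ad (t x + y)^(p-1) (x).                                                     *)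
Definition adpoly x y (u : nat -> L) : nat -> L :=
  fun i => (if i is j.+1 then \[x, u j] else 0) + \[y, u i].

Definition jacobson_s (p : nat) x y (i : nat) : L :=
  i%:R^-1 *:
    iter p.-1 (adpoly x y) (fun j => if j is 0%N then x else 0) i.-1.

Record poperation (p : nat) := POperation {
  pfun :> L -> L;
  pop_ad : forall x y, \[pfun x, y] = iter p (@lieb F L x) y;
  popZ : forall a x, pfun (a *: x) = a ^+ p *: pfun x;
  popD : forall x y,
    pfun (x + y) = pfun x + pfun y + \sum_(1 <= i < p) jacobson_s p x y i
}.

Section PStable.
Variables (p : nat) (pm : poperation p).

Definition pstable U : Prop := forall x, x \in U -> pm x \in U.

Definition psubalgebra U : Prop := subalgebra U /\ pstable U.

Definition pideal U : Prop := ideal U /\ pstable U.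

Definition minimal_pideal U : Prop :=
  [/\ pideal U, U <> 0%VS &
      forall V, pideal V -> V <> 0%VS -> (V <= U)%VS -> V = U].

Definition primitive : Prop :=
  soluble /\ exists2 A : {vspace L}, minimal_pideal A & centv A = A.

Definition atom : Prop :=
  [/\ soluble, fullv <> 0%VS :> {vspace L} &
      forall U, psubalgebra U -> U = 0%VS \/ U = fullv].

End PStable.
End Bracket.

Arguments soluble {F} L.

Section QuotVect.
Import VectorInternalTheory.
Variables (F : fieldType) (V : vectType F) (K : {vspace V}).

Definition quotv : Type := {quot K}.

HB.instance Definition _ := Choice.on quotv.
HB.instance Definition _ := EqQuotient.on quotv.
HB.instance Definition _ := GRing.Zmodule.on quotv.
HB.instance Definition _ := ZmodQuotient.on quotv.

Lemma quotvE (x y : V) : (\pi_quotv x == \pi_quotv y) = (x - y \in K).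
Proof. by rewrite piE. Qed.

Lemma quotv_repr (x : V) : repr (\pi_quotv x) - x \in K.
Proof. by rewrite -quotvE reprK. Qed.

Lemma quotv_piD (x y : V) : \pi_quotv (x + y) = \pi_quotv x + \pi_quotv y.
Proof. exact: pi_add. Qed.

Definition quotv_scale (a : F) (x : quotv) : quotv := \pi_quotv (a *: repr x).

Lemma quotv_scaleE a (x : V) : quotv_scale a (\pi_quotv x) = \pi_quotv (a *: x).
Proof. by apply/eqP; rewrite quotvE -scalerBr memvZ ?quotv_repr. Qed.

Fact quotv_scalerA a b (x : quotv) :
  quotv_scale a (quotv_scale b x) = quotv_scale (a * b) x.
Proof. by rewrite -[x]reprK (quotv_scaleE b) !quotv_scaleE scalerA. Qed.

Fact quotv_scale1r : left_id 1 quotv_scale.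
Proof. by move=> x; rewrite -[x]reprK !quotv_scaleE scale1r. Qed.

Fact quotv_scalerDr : right_distributive quotv_scale +%R.
Proof.
move=> a x y; rewrite -[x]reprK -[y]reprK -quotv_piD !quotv_scaleE.
by rewrite scalerDr quotv_piD.
Qed.

Fact quotv_scalerDl x : {morph quotv_scale^~ x : a b / a + b}.
Proof.
by move=> a b; rewrite -[x]reprK !quotv_scaleE scalerDl quotv_piD.
Qed.

HB.instance Definition _ := GRing.Zmodule_isLmodule.Build F quotv
  quotv_scalerA quotv_scale1r quotv_scalerDr quotv_scalerDl.

Lemma quotv_piZ a (x : V) : \pi_quotv (a *: x) = a *: \pi_quotv x.
Proof. by rewrite -quotv_scaleE. Qed.

Fact quotv_pi_linear : linear (\pi_quotv : V -> quotv).
Proof. by move=> a x y; rewrite quotv_piD quotv_piZ. Qed.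

HB.instance Definition _ :=
  GRing.isLinear.Build F V quotv *:%R \pi_quotv quotv_pi_linear.

Let C := (K^C)%VS.

Let toC (x : quotv) : subvs_of C := vsproj C (daddv_pi C K (repr x)).

Let dCK : (C :&: K = 0)%VS.
Proof. by rewrite capvC capv_compl. Qed.

Let sumCK : (C + K = fullv)%VS.
Proof. by rewrite addvC addv_complf. Qed.

Let KCE (x : V) : (daddv_pi C K x == 0) = (x \in K).
Proof.
have xE : x = daddv_pi C K x + daddv_pi K C x.
  by rewrite daddv_pi_add // sumCK memvf.
apply/eqP/idP => [x0|xK]; first by rewrite xE x0 add0r memv_pi.
have: daddv_pi C K x \in (C :&: K)%VS.
  rewrite memv_cap memv_pi /=.
  have -> : daddv_pi C K x = x - daddv_pi K C x by rewrite {2}xE addrK.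
  by rewrite rpredB // memv_pi.
by rewrite dCK memv0 => /eqP.
Qed.

Let toCE (x : V) : toC (\pi_quotv x) = vsproj C (daddv_pi C K x).
Proof.
congr vsproj; apply/eqP.
by rewrite -subr_eq0 -linearB KCE quotv_repr.
Qed.

Fact quotv_vect_iso : Vector.axiom (\dim C) quotv.
Proof.
exists (fun x => v2r (toC x)).
  move=> a x y; rewrite -[x]reprK -[y]reprK -quotv_pi_linear !toCE.
  by rewrite !linearP.
exists (fun v => \pi_quotv (vsval (r2v v))) => [x | v].
  rewrite v2rK -[x]reprK toCE vsprojK ?memv_pi //; apply/eqP.
  rewrite quotvE -KCE linearB /= (daddv_pi_id dCK (memv_pi _ _ _)).
  by rewrite subrr.
by rewrite toCE (daddv_pi_id dCK) ?subvsP // vsvalK r2vK.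
Qed.

HB.instance Definition _ := Lmodule_hasFinDim.Build F quotv quotv_vect_iso.

End QuotVect.

Section QuotLie.
Variables (F : fieldType) (L : lieAlgType F) (K : {vspace L}) (iK : ideal K).

(* The proof iK is an argument so that the Lie structure can be inferred. *)
Definition quotl of ideal K : Type := quotv K.
Local Notation Q := (quotl iK).

HB.instance Definition _ := SemiVector.on Q.
HB.instance Definition _ := Vector.on Q.
HB.instance Definition _ := EqQuotient.on Q.

Lemma idealr x y : x \in K -> \[x, y] \in K.
Proof. by move=> xK; rewrite liebC rpredN iK. Qed.

Definition quotl_lieb (x y : Q) : Q := \pi_Q \[repr x, repr y].

Lemma quotl_liebE (x y : L) :
  quotl_lieb (\pi_Q x) (\pi_Q y) = \pi_Q \[x, y].
Proof.
apply/eqP; rewrite quotvE.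
set x' := repr _; set y' := repr _.
have -> : \[x', y'] - \[x, y] = \[x' - x, y'] + \[x, y' - y].
  by rewrite liebDl liebDr liebNl liebNr addrA addrNK.
by rewrite rpredD ?(idealr _ (quotv_repr _ _)) ?iK ?quotv_repr.
Qed.

Fact quotl_liebl y : linear (quotl_lieb^~ y).
Proof.
move=> a u v; rewrite -[u]reprK -[v]reprK -[y]reprK.
rewrite -quotv_pi_linear !quotl_liebE liebl_linear.
exact: quotv_pi_linear.
Qed.

Fact quotl_liebr x : linear (quotl_lieb x).
Proof.
move=> a u v; rewrite -[u]reprK -[v]reprK -[x]reprK.
rewrite -quotv_pi_linear !quotl_liebE liebr_linear.
exact: quotv_pi_linear.
Qed.

Fact quotl_liebxx x : quotl_lieb x x = 0.
Proof.
rewrite -[x]reprK quotl_liebE liebxx; exact: (linear0 \pi_(quotv K)).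
Qed.

Fact quotl_jacobi x y z : quotl_lieb x (quotl_lieb y z) +
  quotl_lieb y (quotl_lieb z x) + quotl_lieb z (quotl_lieb x y) = 0.
Proof.
rewrite -[x]reprK -[y]reprK -[z]reprK.
rewrite (quotl_liebE (repr x) (repr y)) (quotl_liebE (repr y) (repr z)).
rewrite (quotl_liebE (repr z) (repr x)) !quotl_liebE -!quotv_piD lieb_jacobi.
exact: (linear0 \pi_(quotv K)).
Qed.

HB.instance Definition _ := isLieAlgebra.Build F Q
  quotl_liebl quotl_liebr quotl_liebxx quotl_jacobi.

Lemma quotl_pi_lieb (x y : L) : \pi_Q \[x, y] = \[\pi_Q x, \pi_Q y].
Proof. by rewrite -quotl_liebE. Qed.

Lemma quotl_pi_iter (x y : L) n :
  \pi_Q (iter n (@lieb F L x) y) = iter n (@lieb F Q (\pi_Q x)) (\pi_Q y).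
Proof. by elim: n => //= n <-; rewrite quotl_pi_lieb. Qed.

Lemma quotl_pi_jacobson p (x y : L) i :
  \pi_Q (jacobson_s p x y i) = jacobson_s p (\pi_Q x) (\pi_Q y) i.
Proof.
rewrite /jacobson_s [LHS]quotv_piZ; congr (_ *: _).
elim: p.-1 (i.-1) => [|n IH] j /=.
  by case: j => // j; apply: (linear0 \pi_(quotv K)).
rewrite /adpoly [LHS]quotv_piD; congr (_ + _); last first.
  by rewrite -IH -quotl_pi_lieb.
case: j => [|j]; first exact: (linear0 \pi_(quotv K)).
by rewrite -IH -quotl_pi_lieb.
Qed.

Lemma jacobson_s_ideal p x y i :
  y \in K -> (1 < p)%N -> jacobson_s p x y i \in K.
Proof.
move=> yK; case: p => [|[|p]] // _; rewrite /jacobson_s memvZ //=.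
elim: p (i.-1) => [|p IH] j;
  rewrite [iter _ _ _]/= {1}/adpoly rpredD ?idealr //.
  by case: j => [|[|j]]; rewrite ?liebxx ?lieb0r mem0v.
by case: j => [|j]; rewrite ?mem0v // iK.
Qed.

Section QuotPOperation.
Variables (p : nat) (pm : poperation L p) (sK : pstable pm K).

Definition quotl_pfun (x : Q) : Q := \pi_Q (pm (repr x)).

Lemma quotl_pfunE (x : L) : quotl_pfun (\pi_Q x) = \pi_Q (pm x).
Proof.
apply/eqP; rewrite quotvE.
have := quotv_repr K x; set k := _ - x => kK.
have -> : repr (\pi_Q x) = x + k by rewrite addrC subrK.
rewrite popD addrC !addrA addNr add0r.
rewrite rpredD ?sK // big_nat_cond rpred_sum // => i /andP[/andP[i1 ip] _].
by rewrite jacobson_s_ideal // (leq_trans _ ip).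
Qed.

Fact quotl_pop_ad x y : \[quotl_pfun x, y] = iter p (@lieb F Q x) y.
Proof.
rewrite -[x]reprK -[y]reprK quotl_pfunE -quotl_pi_lieb pop_ad.
exact: quotl_pi_iter.
Qed.

Fact quotl_popZ a x : quotl_pfun (a *: x) = a ^+ p *: quotl_pfun x.
Proof.
rewrite -[x]reprK.
have <- : \pi_Q (a *: repr x) = a *: \pi_Q (repr x) by apply: quotv_piZ.
by rewrite !quotl_pfunE popZ; apply: quotv_piZ.
Qed.

Fact quotl_popD x y : quotl_pfun (x + y) =
  quotl_pfun x + quotl_pfun y + \sum_(1 <= i < p) jacobson_s p x y i.
Proof.
rewrite -[x]reprK -[y]reprK.
have <- : \pi_Q (repr x + repr y) = \pi_Q (repr x) + \pi_Q (repr y).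
  exact: quotv_piD.
rewrite !quotl_pfunE popD [LHS]quotv_piD.
congr (_ + _); first exact: quotv_piD.
rewrite [LHS](linear_sum \pi_(quotv K)); apply: eq_bigr => i _.
exact: quotl_pi_jacobson.
Qed.

Definition quot_pop : poperation Q p :=
  POperation quotl_pop_ad quotl_popZ quotl_popD.

End QuotPOperation.
End QuotLie.

Definition restricted_iso (F : fieldType) (p : nat)
    (L M : lieAlgType F) (pm : poperation L p) (qm : poperation M p) : Prop :=
  exists f : {linear L -> M},
    [/\ bijective f, forall x y, f \[x, y] = \[f x, f y] &
        forall x, f (pm x) = qm (f x)].

Definition rlie_coll (F : fieldType) (p : nat) : Type :=
  forall L : lieAlgType F, poperation L p -> Prop.

Definition soluble_class (F : fieldType) (p : nat) (X : rlie_coll F p) : Prop :=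
  (forall (L : lieAlgType F) (pm : poperation L p), X L pm -> soluble L) /\
  (forall (L M : lieAlgType F) (pm : poperation L p) (qm : poperation M p),
     restricted_iso pm qm -> X L pm -> X M qm).

Definition pSchunck (F : fieldType) (p : nat) (X : rlie_coll F p) : Prop :=
  [/\ soluble_class X,
      exists (L : lieAlgType F) (pm : poperation L p), X L pm &
      forall (L : lieAlgType F) (pm : poperation L p),
        X L pm <->
        soluble L /\
        forall (K : {vspace L}) (iK : ideal K) (sK : pstable pm K),
          primitive (quot_pop iK sK) -> X (quotl iK) (quot_pop iK sK)].

(* Main.v *)
Require Import Defs.
From HB Require Import structures.
From mathcomp Require Import all_boot all_order all_algebra.
Local Open Scope ring_scope.
Import GRing.Theory.

(** A primitive quotient of $L$ that is not an atom has zero centre, and then its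
    $p$-operation is determined by the bracket.

    Let $P = (L/K, [p]')$ be a primitive quotient with self-centralising minimal
    $[p]'$-ideal $A$.  The centre $Z$ of $P$ is a $[p]'$-ideal contained in
    $C(A) = A$.  If $Z$ is nonzero, minimality gives $Z = A$, so everything
    centralises $A$ and $P = A$ is an atom ([primitive_atom_or_centreless]);
    atoms are in the class by hypothesis.

    If $Z = 0$, then for $k$ in $K$ the derivation $ad(k^{[p]}) = ad(k)^p$ maps
    $L$ into $K$, so $k^{[p]}$ is central modulo $K$, hence lies in $K$: thus
    $K$ is also a $[p]$-ideal ([pstable_of_centreless_quot]).  The two operations
    on $L/K$ differ by central elements, so they coincide
    ([poperation_unique]), and $P$ is a primitive quotient of $(L, [p])$.  It is
    in the class because $(L, [p])$ is. *)

Section Centre.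
Variables (F : fieldType) (L : lieAlgType F) (p : nat).
Implicit Types (pm qm : poperation L p).

Lemma centre_pideal pm : (0 < p)%N -> pideal pm (centv fullv).
Proof.
move=> p_gt0; split=> [x y /centvP cy | x /centvP cx].
  by rewrite liebC cy ?memvf // oppr0 mem0v.
apply/centvP => a _; rewrite pop_ad -(prednK p_gt0) /=.
by rewrite cx ?memvf.
Qed.

(** If the centre $Z$ is nonzero, minimality of the self-centralising ideal $A$
    forces $A = Z$, and then $A$ is the whole algebra.  Every subspace of that
    abelian algebra is an ideal, so the minimality of $A$ among $[p]$-ideals is
    minimality among $[p]$-subalgebras. *)
Lemma primitive_atom_or_centreless pm :
  (0 < p)%N -> primitive pm -> atom pm \/ centv (fullv : {vspace L}) = 0%VS.
Proof.
move=> p_gt0 [solL [A [_ A_neq0 minA] cA]].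
have [-> | /eqP Z_neq0] := eqVneq (centv (fullv : {vspace L})) 0%VS.
  by right.
left.
have ZA : centv fullv = A.
  apply: minA => //; first exact: centre_pideal.
  apply/subvP => x /centvP cx; rewrite -cA; apply/centvP => a _.
  by apply: cx; rewrite memvf.
have Afull : A = fullv.
  apply/vspaceP => x; rewrite memvf -cA; apply/centvP => a.
  by rewrite -ZA => /centvP ca; rewrite liebC ca ?memvf // oppr0.
split=> [//||U [_ pU]]; first by rewrite -Afull.
have [-> | /eqP U_neq0] := eqVneq U 0%VS; first by left.
right; rewrite -Afull; apply: minA => //; last by rewrite Afull subvf.
split=> // x y _; have : x \in centv fullv by rewrite ZA Afull memvf.
by move/centvP->; rewrite ?memvf ?mem0v.
Qed.

(** Both $p$-th powers of $x$ have adjoint map $ad(x)^p$, so they differ by a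
    central element. *)
Lemma poperation_unique pm qm :
  centv (fullv : {vspace L}) = 0%VS -> pm =1 qm.
Proof.
move=> Z0 x; apply/eqP; rewrite -subr_eq0 -memv0 -Z0.
by apply/centvP => y _; rewrite liebDl liebNl !pop_ad subrr.
Qed.

Lemma eq_primitive pm qm : pm =1 qm -> primitive pm -> primitive qm.
Proof.
move=> eq_pq [solL [A [[iA sA] A_neq0 minA] cA]].
split=> //; exists A => //; split=> // [|V [iV sV]].
  by split=> // x xA; rewrite -eq_pq sA.
by apply: minA; split=> // x xV; rewrite eq_pq sV.
Qed.

Lemma eq_restricted_iso pm qm : pm =1 qm -> restricted_iso pm qm.
Proof.
move=> eq_pq; exists (idfun : {linear L -> L}); split=> //.
by exists id.
Qed.

(** For $k$ in $K$, the derivation $ad(k^{[p]}) = ad(k)^p$ maps into $K$, so the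
    image of $k^{[p]}$ in the quotient is central. *)
Lemma pstable_of_centreless_quot pm (K : {vspace L}) (iK : ideal K) :
  (0 < p)%N -> centv (fullv : {vspace quotl iK}) = 0%VS -> pstable pm K.
Proof.
move=> p_gt0 Z0 k kK.
have: \pi_(quotl iK)%qT (pm k) \in centv (fullv : {vspace quotl iK}).
  apply/centvP => a _; rewrite -[a]reprK -quotl_pi_lieb pop_ad.
  rewrite -(prednK p_gt0) /=.
  apply/eqP; rewrite -(linear0 \pi_(quotv K)%qT) quotvE subr0.
  exact: (Defs.idealr iK _ kK).
rewrite Z0 memv0 -(linear0 \pi_(quotv K)%qT) quotvE.
by rewrite subr0.
Qed.

End Centre.

Arguments primitive_atom_or_centreless {F L p pm}.
Arguments poperation_unique {F L p}.
Arguments eq_primitive {F L p pm qm}.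
Arguments eq_restricted_iso {F L p pm qm}.
Arguments pstable_of_centreless_quot {F L p} pm {K iK}.

Theorem theorem4p15 (F : fieldType) (p : nat) (hp : p \in [pchar F])
    (H : rlie_coll F p) (hH : pSchunck H)
    (hatoms : forall (L : lieAlgType F) (pm : poperation L p), atom pm -> H L pm)
    (L : lieAlgType F) (pm pm' : poperation L p) :
  H L pm -> H L pm'.
Proof.
have p_gt0 : (0 < p)%N by apply/prime_gt0/pcharf_prime/hp.
have [[_ Hiso] _ HP] := hH.
move=> /HP[solL Hquot]; apply/HP; split=> // K iK sK' primK'.
have [/hatoms // | Z0] := primitive_atom_or_centreless p_gt0 primK'.
have sK : pstable pm K by exact: pstable_of_centreless_quot p_gt0 Z0.
have eqK := poperation_unique (quot_pop iK sK') (quot_pop iK sK) Z0.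
apply: (Hiso _ _ (quot_pop iK sK)); last first.
  exact/Hquot/(eq_primitive eqK).
exact/eq_restricted_iso/fsym.
Qed.
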